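(* Let $m\ge2$ and let $\Omega\subseteq\mathbb{R}^m$ be a set of nonzero $m$-dimensional volume with $t(\Omega)<\infty$. Let $\mathcal{S}\subseteq\Omega\cap\mathbb{Z}^m$ be a set of integer points and $S=\#\mathcal{S}$. Let $\mathcal{L}$ be a nonempty finite set of lattices $\Gamma\subseteq\mathbb{Z}^m$ (of full rank $m$). Suppose that for each $\Gamma\in\mathcal{L}$ the points of $\mathcal{S}$ belong to at most $\nu(\Gamma)$ equivalence classes of $\mathbb{Z}^m/\Gamma$, where $\nu(\Gamma)\ge1$ is an integer, and that $$D(v_1,\dots,v_{m+1})>0\quad\text{for all pairwise distinct } v_1,\dots,v_{m+1}\in\mathcal{S}.$$ Suppose also that the values $|\Gamma|$, $\Gamma\in\mathcal{L}$, are pairwise coprime. If $$\sum_{\Gamma\in\mathcal{L}}\frac{\log|\Gamma|}{\nu(\Gamma)^m}-\log t(\Omega)>0,$$ then $$S<\max\left(\gamma_m\max_{\substack{1\le s\le m\\ 2\nmid s}}\left(\frac{\sum_{\Gamma\in\mathcal{L}}\frac{\log|\Gamma|}{\nu(\Gamma)^{m-s}}-\log t(\Omega)}{\sum_{\Gamma\in\mathcal{L}}\frac{\log|\Gamma|}{\nu(\Gamma)^{m}}-\log t(\Omega)}\right)^{1/s},\ (m+1)\max_{\Gamma\in\mathcal{L}}\nu(\Gamma)\right),$$ where $\gamma_m:=\left\lfloor\frac{m+1}{2}\right\rfloor\frac{m(m+1)}{2}$.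
   Context: For points $v_1,\dots,v_{m+1}\in\mathbb{R}^m$ (viewed as column vectors), $D(v_1,\dots,v_{m+1})$ denotes the absolute value of the determinant of the $(m+1)\times(m+1)$ matrix $$\begin{pmatrix}1&1&\cdots&1\\ v_1&v_2&\cdots&v_{m+1}\end{pmatrix}.$$ For a set $\Omega\subseteq\mathbb{R}^m$, $t(\Omega):=\sup_{v_1,\dots,v_{m+1}\in\Omega}D(v_1,\dots,v_{m+1})$. For a lattice $\Gamma\subseteq\mathbb{Z}^m$ of full rank, $|\Gamma|$ denotes the $m$-dimensional volume of the fundamental parallelepiped of $\Gamma$ (equivalently its index in $\mathbb{Z}^m$). *)

(* Defs.v *)
From HB Require Import structures.
From mathcomp Require Import all_boot all_order all_algebra.
From mathcomp Require Import finmap.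
From mathcomp Require Import all_classical all_reals all_analysis.

Set Implicit Arguments.
Unset Strict Implicit.
Unset Printing Implicit Defensive.

Import Order.TTheory GRing.Theory Num.Theory.
Import numFieldNormedType.Exports.

Local Open Scope classical_set_scope.
Local Open Scope ring_scope.

Section Volume.
Context {R : realType} {m : nat}.

Definition box (a b : 'cV[R]_m) : set 'cV[R]_m :=
  [set x | forall i, a i 0 <= x i 0 <= b i 0].

Definition box_volume (a b : 'cV[R]_m) : R := \prod_(i < m) (b i 0 - a i 0).

(* The m-dimensional Lebesgue outer measure. It is the Lebesgue measure on
   measurable sets, and it is also meaningful on arbitrary sets. *)
Definition volume (A : set 'cV[R]_m) : \bar R :=
  ereal_inf [set v : \bar R | exists a b : nat -> 'cV[R]_m,
    [/\ forall k i, a k i 0 <= b k i 0,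
        A `<=` \bigcup_k box (a k) (b k) &
        v = (\sum_(0 <= k <oo) (box_volume (a k) (b k))%:E)%E]].

End Volume.

Section Simplex.
Context {R : realType} {m : nat}.

Definition simplex_mx (v : 'I_m.+1 -> 'cV[R]_m) : 'M[R]_m.+1 :=
  col_mx (const_mx 1 : 'rV[R]_m.+1) (\matrix_(i < m, j < m.+1) v j i 0).

Definition D (v : 'I_m.+1 -> 'cV[R]_m) : R := `|\det (simplex_mx v)|.

Definition t (Omega : set 'cV[R]_m) : \bar R :=
  ereal_sup [set (D v)%:E | v in [set v | forall j, Omega (v j)]].

End Simplex.

(* The inclusion of Z^m into R^m. *)
Definition int_point (R : realType) (m : nat) (v : 'cV[int]_m) : 'cV[R]_m :=
  map_mx intr v.
Arguments int_point R {m} v.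

Section Lattice.
Context {m : nat}.

Definition full_rank_lattice (Gamma : set 'cV[int]_m) : Prop :=
  exists2 B : 'M[int]_m, \det B != 0 & Gamma = range (fun x => B *m x).

Definition lattice_class (Gamma : set 'cV[int]_m) (v : 'cV[int]_m) :
    set 'cV[int]_m :=
  [set w | Gamma (w - v)].

(* The set of the classes of Z^m / Gamma that meet A. *)
Definition lattice_classes (Gamma A : set 'cV[int]_m) : set (set 'cV[int]_m) :=
  [set lattice_class Gamma v | v in A].

(* |Gamma|, as the number of classes of Z^m / Gamma, which is finite when
   Gamma has full rank. (fset_set sends infinite sets to fset0.) *)
Definition lattice_index (Gamma : set 'cV[int]_m) : nat :=
  #|` fset_set (lattice_classes Gamma setT)|.

End Lattice.

Definition gamma (R : realType) (m : nat) : R :=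
  (m.+1 %/ 2)%:R * ((m * m.+1)%:R / 2).

(* Main.v *)
Require Import Defs.
From HB Require Import structures.
From mathcomp Require Import all_boot all_order all_algebra.
From mathcomp Require Import finmap.
From mathcomp Require Import all_classical all_reals all_analysis.
From mathcomp Require Import ring lra zify.

Set Implicit Arguments.
Unset Strict Implicit.
Unset Printing Implicit Defensive.

Import Order.TTheory GRing.Theory Num.Theory.
Import numFieldNormedType.Exports.

Local Open Scope classical_set_scope.
Local Open Scope ring_scope.

(** The proof is a larger sieve, in which the size of the integer determinants
    D(v) plays the role of the length of the interval.

    If m+1 integer points lie in one class of Z^m / Gamma, then Gamma contains
    their differences, so the index of Gamma divides D(v)
    ([lattice_index_dvd]).  As the indices are coprime, the product of those
    that are caught in this way divides D(v), and D(v) is a positive integer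
    which is at most t(Omega).  Hence the sum of the log |Gamma| over the Gamma
    that see v in a single class is at most log t(Omega) ([sum_ln_index_le]).

    Sum this over all injective (m+1)-tuples taken from n points of S.  The
    right side becomes n(n-1)...(n-m) log t(Omega).  On the left, log |Gamma| is
    counted at least as often as the sum of Z_a(Z_a-1)...(Z_a-m), where Z_a is
    the number of points in the class a.  There are nu classes, so if
    n >= (m+1)nu, convexity of the falling factorial ([ffact_tangent]) bounds
    that sum below by its value at Z_a = n/nu.  This is [sieve_inequality].
    Divide it by n^(m+1) and expand in powers of 1/n, with e_s denoting the
    elementary symmetric polynomials of 1, ..., m:

      sum_s (-1)^s e_s n^(-s) A_s <= 0,
      A_s = sum_Gamma log|Gamma| / nu(Gamma)^(m-s) - log t(Omega).

    All the A_s are at least A_0 > 0, so the terms with s odd must outweigh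
    A_0, strictly so because of the term s = 2.  There are floor((m+1)/2) of
    them, hence one exceeds its share of A_0, and e_s <= (1 + ... + m)^s turns
    this into the stated bound for n ([lt_gamma_bigmax]).  The bound holds for
    the size n of every finite subset of S, and so it also shows that S is
    finite. *)

(** * Falling factorials *)

(** The tangent line to the falling factorial x(x-1)...(x-k+1) at a real point
    x >= k-1, to the right of which the polynomial is convex, lies below its
    values at all natural numbers.  Those z below k-1 are not in the convex
    range, but there the falling factorial vanishes.  In the induction the
    inequality for k is multiplied by z - k; its remainder g * (z - x)^2 has the
    right sign because the slope g is nonnegative. *)
Lemma ffact_tangent (R : realFieldType) (k : nat) (x : R) : k%:R <= x + 1 ->
  exists2 g : R, 0 <= g & forall z : nat,
    \prod_(i < k) (x - i%:R) + g * (z%:R - x) <= (z ^_ k)%:R.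
Proof.
elim: k x => [|k IHk] x hx.
  by exists 0 => // z; rewrite big_ord0 ffactn0 mul0r addr0.
have hkx : k%:R <= x by rewrite -natr1 lerD2r in hx.
have [g g0 hg] := IHk x (le_trans hkx (ltW (ltr_pwDr ltr01 (lexx x)))).
have P0 : 0 <= \prod_(i < k) (x - i%:R).
  apply: prodr_ge0 => i _; rewrite subr_ge0; apply: le_trans hkx.
  by rewrite ler_nat ltnW.
set P := \prod_(i < k) _ in hg P0.
(* The product rule for the derivative of P(x) * (x - k). *)
exists (P + g * (x - k%:R)) => [|z].
  by rewrite addr_ge0 // mulr_ge0 // subr_ge0.
rewrite big_ord_recr /= -/P ffactnSr natrM.
have [zk|kz] := ltnP z k.
  have zk' : z%:R <= k%:R :> R by rewrite ler_nat ltnW.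
  have -> : (z - k)%N = 0%N by apply/eqP; rewrite subn_eq0 ltnW.
  rewrite mulr0.
  have := mulr_ge0 P0 (_ : 0 <= k%:R - z%:R); rewrite subr_ge0 => /(_ zk').
  have := mulr_ge0 (mulr_ge0 g0 (_ : 0 <= x - k%:R)) (_ : 0 <= x - z%:R).
  rewrite !subr_ge0 => /(_ hkx (le_trans zk' hkx)).
  lra.
have kz' : k%:R <= z%:R :> R by rewrite ler_nat.
rewrite natrB //.
have /(ler_wpM2r (_ : 0 <= z%:R - k%:R)) := hg z.
rewrite subr_ge0 => /(_ kz'); apply: le_trans.
have := mulr_ge0 g0 (sqr_ge0 (z%:R - x)).
rewrite expr2; lra.
Qed.

(** [esym_upto m s] is the s-th elementary symmetric polynomial at 1, ..., m,
    that is the unsigned Stirling number of the first kind c(m+1, m+1-s). *)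
Fixpoint esym_upto (m s : nat) : nat :=
  match m, s with
  | _, 0 => 1
  | 0, _.+1 => 0
  | m'.+1, s'.+1 => esym_upto m' s'.+1 + m * esym_upto m' s'
  end.

Lemma esym_upto0 m : esym_upto m 0 = 1%N. Proof. by case: m. Qed.

Lemma esym_upto_gt m s : (m < s)%N -> esym_upto m s = 0%N.
Proof.
elim: m s => [|m IHm] [|s] //= ms.
by rewrite !IHm ?muln0 // ltnW.
Qed.

Lemma esym_upto_gt0 m s : (s <= m)%N -> (0 < esym_upto m s)%N.
Proof.
elim: m s => [|m IHm] [|s] //= ms.
by rewrite addn_gt0 orbC muln_gt0 /= IHm.
Qed.

(** Each monomial of e_s(1, ..., m) occurs in the expansion of
    (1 + ... + m)^s, and 1 + ... + m is 'C(m+1, 2). *)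
Lemma esym_upto_le m s : (esym_upto m s <= 'C(m.+1, 2) ^ s)%N.
Proof.
elim: m s => [|m IHm] [|s] //.
have IHs := IHm s; have IHSs := IHm s.+1.
rewrite [esym_upto _ _]/= [X in (_ <= X ^ _)%N]binS bin1.
move: ('C(m.+1, 2)) m.+1 IHs IHSs => a b IHs IHSs.
apply: leq_trans (leq_add IHSs (leq_mul (leqnn b) IHs)) _.
rewrite !expnS -mulnDl leq_mul //.
by case: s {IHs IHSs} => // s; rewrite leq_exp2r // leq_addr.
Qed.

Lemma esym_uptoE (R : comPzRingType) (m : nat) (u : R) :
  \prod_(i < m) (1 - i.+1%:R * u) = \sum_(s < m.+1) (esym_upto m s)%:R * (- u) ^+ s.
Proof.
elim: m => [|m IHm]; first by rewrite big_ord0 big_ord1 mulr1.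
rewrite big_ord_recr IHm [in RHS]big_ord_recl esym_upto0 expr0 mulr1.
under [in RHS]eq_bigr => i _ do rewrite lift0 /= natrD mulrDl.
rewrite big_split /= addrA mulrBr mulr1; congr (_ + _).
  rewrite [in LHS]big_ord_recl [in RHS]big_ord_recr /= esym_upto0 esym_upto_gt // mul0r.
  by rewrite addr0 expr0 mul1r.
rewrite mulr_suml -sumrN; apply: eq_bigr => i _.
rewrite natrM exprS; ring.
Qed.

Lemma natr_ffact (R : pzRingType) (n k : nat) :
  (n ^_ k)%:R = \prod_(i < k) (n%:R - i%:R) :> R.
Proof.
elim: k => [|k IHk]; first by rewrite big_ord0.
rewrite big_ord_recr /= -IHk ffactnSr natrM.
have [nk|kn] := ltnP n k; last by rewrite natrB.
by rewrite ffact_small // !mul0r.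
Qed.

(** The case y = 1 is n(n-1)...(n-m) itself; y = nu is its analogue for points
    spread evenly over nu classes.  The powers of 1/x do not depend on y, which
    is what allows these expansions to be added over the lattices. *)
Lemma falling_expansion (R : fieldType) (m : nat) (x y : R) :
  x != 0 -> y != 0 ->
  x * \prod_(i < m) (x / y - i.+1%:R) =
    x ^+ m.+1 * \sum_(s < m.+1) (esym_upto m s)%:R * (- x^-1) ^+ s / y ^+ (m - s).
Proof.
move=> x0 y0; rewrite exprS -mulrA; congr (_ * _).
have -> : \prod_(i < m) (x / y - i.+1%:R) =
    \prod_(i < m) ((x / y) * (1 - i.+1%:R * (y / x))).
  by apply: eq_bigr => i _; field; rewrite x0.
rewrite big_split /= prodr_const card_ord esym_uptoE expr_div_n -mulrA.
congr (_ * _); rewrite mulr_sumr; apply: eq_bigr => s _.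
have -> : y ^+ m = y ^+ (m - s) * y ^+ s by rewrite -exprD subnK // -ltnS.
have -> : - (y / x) = - x^-1 * y by rewrite mulNr mulrC.
by rewrite exprMn; field; rewrite !expf_neq0.
Qed.

(** * From the alternating sum to the bound *)

Lemma gammaE (R : realType) (m : nat) :
  gamma R m = (m.+1)./2%:R * ('C(m.+1, 2))%:R.
Proof.
rewrite /gamma divn2; congr (_ * _).
have : (2 * 'C(m.+1, 2))%N%:R = (m * m.+1)%N%:R :> R.
  by congr (_%:R); rewrite -mul_bin_diag bin1 mulnC.
by rewrite natrM => <-; rewrite mulrC mulKf // pnatr_eq0.
Qed.

Lemma sum_odd_ord (n : nat) : (\sum_(s < n | odd s) 1 = n./2)%N.
Proof.
elim: n => [|n IHn]; first by rewrite big_ord0.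
by rewrite big_mkcond big_ord_recr -big_mkcond /= IHn uphalf_half addnC; case: odd.
Qed.

(** If n reached the bound, then for s odd e_s n^(-s) A_s would be at most
    A_0 / K, where K is the number of odd s in 1, ..., m; so the odd terms
    together could not exceed A_0, which the terms s = 0 and s = 2 beat. *)
Lemma lt_gamma_bigmax (R : realType) (m : nat) (A : nat -> R) (n : R) :
  (2 <= m)%N -> 0 < n -> (forall s, 0 < A s) ->
  \sum_(s < m.+1) (esym_upto m s)%:R * (- n^-1) ^+ s * A s <= 0 ->
  n < gamma R m *
       \big[Num.max/0]_(1 <= s < m.+1 | ~~ (2 %| s)%N) (A s / A 0%N) `^ (s%:R^-1).
Proof.
move=> m2 n0 Apos; have A0 := Apos 0%N; apply: contraTT; rewrite -leNgt -ltNge => hn.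
set M := \big[_/_]_(_ <= _ < _ | _) _ in hn.
set K : R := (m.+1)./2%:R.
have K1 : 1 <= K by rewrite ler1n; lia.
have K0 : 0 < K by apply: lt_le_trans K1.
set C : R := ('C(m.+1, 2))%:R.
have C0 : 0 < C by rewrite ltr0n bin_gt0 ltnS ltnW.
(* K counts the odd s, and gamma = K * C with C = 1 + ... + m. *)
have odd_term (s : 'I_m.+1) : odd s ->
    (esym_upto m s)%:R * n^-1 ^+ s * A s <= A 0%N / K.
  move=> sodd; have s0 : (0 < s)%N by case: (s : nat) sodd.
  have rM : (A s / A 0%N) `^ (s%:R^-1) <= M.
    pose F r := (A r / A 0%N) `^ (r%:R^-1).
    apply: (@le_bigmax_seq _ _ _ _ _ (s : nat) _ F); last by rewrite dvdn2 sodd.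
    by rewrite mem_index_iota s0 ltn_ord.
  have r0 : 0 <= A s / A 0%N by rewrite divr_ge0 // ltW.
  have rs : A s / A 0%N <= (n / (K * C)) ^+ s.
    have -> : A s / A 0%N = ((A s / A 0%N) `^ (s%:R^-1)) ^+ s.
      rewrite -powR_mulrn ?powR_ge0 // -powRrM mulVf ?powRr1 //.
      by rewrite pnatr_eq0 -lt0n.
    apply: lerXn2r; rewrite ?nnegrE ?powR_ge0 //.
      by rewrite divr_ge0 ?mulr_ge0 // ltW.
    rewrite ler_pdivlMr ?mulr_gt0 // mulrC.
    apply: le_trans hn; rewrite gammaE ler_wpM2l // mulr_ge0 // ltW //.
  rewrite ler_pdivrMr // in rs.
  apply: le_trans (_ : C ^+ s * n^-1 ^+ s * ((n / (K * C)) ^+ s * A 0%N) <= _).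
    apply: ler_pM; rewrite ?mulr_ge0 ?exprn_ge0 ?invr_ge0 ?(ltW n0) ?(ltW (Apos _)) //.
    rewrite ler_wpM2r ?exprn_ge0 ?invr_ge0 ?(ltW n0) //.
    by rewrite -natrX ler_nat esym_upto_le.
  rewrite mulrA -!exprMn.
  have -> : C * n^-1 * (n / (K * C)) = K^-1.
    by field; rewrite !gt_eqF.
  rewrite mulrC ler_wpM2l ?(ltW A0) // -[leRHS]expr1.
  by rewrite ler_wiXn2l // ?invr_ge0 ?invf_le1 // ltW.
rewrite (bigID (fun s : 'I_m.+1 => odd s)) /=.
have oddge : - A 0%N <= \sum_(s < m.+1 | odd s) (esym_upto m s)%:R * (- n^-1) ^+ s * A s.
  have -> : - A 0%N = \sum_(s < m.+1 | odd s) - (A 0%N / K).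
    rewrite sumr_const -sum1_card sum_odd_ord mulNrn -mulr_natr -/K.
    by rewrite divfK // gt_eqF.
  apply: ler_sum => s sodd.
  by rewrite exprNn -signr_odd sodd expr1 mulN1r mulrN mulNr lerN2 odd_term.
apply: lt_le_trans (lerD oddge (lexx _)).
have i2 : (2 < m.+1)%N by [].
(* The term s = 0 cancels against - A 0, and s = 2, which exists as m >= 2,
   makes the rest positive. *)
rewrite (bigD1 (ord0 : 'I_m.+1)) //= (bigD1 (Ordinal i2)) //=.
rewrite esym_upto0 expr0 !mul1r addKr.
apply: ltr_pwDl.
  apply: mulr_gt0 (Apos _); apply: mulr_gt0.
    by rewrite ltr0n esym_upto_gt0.
  by rewrite /= sqrrN exprn_gt0 // invr_gt0.
apply: sumr_ge0 => s /andP[/andP[/negbTE sodd _] _].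
rewrite exprNn -signr_odd sodd expr0 mul1r.
by rewrite !mulr_ge0 ?exprn_ge0 ?invr_ge0 // ltW.
Qed.

(** * The index of a lattice *)

Lemma card_fset_set_range (T : finType) (U : choiceType) (f : T -> U) :
  injective f -> #|` fset_set (range f)| = #|T|.
Proof.
move=> finj.
have -> : range f = [set` [fset f x | x in T]%fset].
  apply/seteqP; split => y /=.
    by move=> [x _ <-]; apply/imfsetP; exists x.
  by move/imfsetP => [x _ ->]; exists x.
rewrite set_fsetK card_imfset //= cardE; congr (size _).
Qed.

Lemma absz_det_unit (m : nat) (L : 'M[int]_m) :
  L \in unitmx -> `|\det L|%N = 1%N.
Proof.
by rewrite unitmxE => /orP[/eqP|/eqP] ->.
Qed.

Lemma lattice_class_eqP (m : nat) (B : 'M[int]_m) (v w : 'cV[int]_m) :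
  lattice_class (range (mulmx B)) v = lattice_class (range (mulmx B)) w <->
  exists x, v - w = B *m x.
Proof.
split => [e|[x e]].
  have : lattice_class (range (mulmx B)) v v.
    by exists 0 => //; rewrite mulmx0 subrr.
  by rewrite e => -[x _ <-]; exists x.
apply/seteqP; split => u [y _ /= hy].
  by exists (y + x) => //; rewrite mulmxDr hy -e addrA subrK.
by exists (y - x) => //; rewrite mulmxBr hy -e opprB addrA subrK.
Qed.

(** By the Smith normal form, B is diagonal up to unimodular changes of basis,
    so a class of Z^m / B Z^m amounts to one residue modulo each of the
    diagonal entries. *)
Lemma lattice_index_det (m : nat) (B : 'M[int]_m) :
  \det B != 0 -> lattice_index (range (mulmx B)) = `|\det B|%N.
Proof.
move=> detB.
have [L uL [U uU [d _ eB]]] := int_Smith_normal_form B.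
pose q (i : 'I_m) : nat := absz (d`_i)%R.
have eD : \matrix_(i, j) (d`_i *+ (i == j)) = diag_mx (\row_(i < m) d`_i).
  by apply/matrixP => i j; rewrite !mxE.
have dq : `|\det B|%N = (\prod_i q i)%N.
  rewrite eB !det_mulmx !abszM (absz_det_unit uL) (absz_det_unit uU).
  rewrite mul1n muln1 eD det_diag.
  rewrite (big_morph _ abszM (erefl : `|1%Z|%N = 1%N)).
  by apply: eq_bigr => i _; rewrite mxE.
have q0 (i : 'I_m) : d`_i != 0.
  rewrite -absz_eq0 -lt0n; have : (0 < \prod_i q i)%N by rewrite -dq absz_gt0.
  by move/gt0_prodn => /(_ i isT).
pose F (f : {dffun forall i : 'I_m, 'I_(q i)}) :=
  lattice_class (range (mulmx B)) (L *m \col_i (f i)%:Z).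
(* In the coordinates given by L the lattice is diagonal. *)
have key (v w : 'cV[int]_m) : (exists x, L *m v - L *m w = B *m x) <->
    forall i, (d`_i %| (v i 0)%R - (w i 0)%R)%Z.
  split => [[x e] i|h].
    have : v - w = diag_mx (\row_i d`_i) *m (U *m x).
      by apply: (can_inj (mulKmx uL)); rewrite mulmxBr e eB eD -!mulmxA.
    rewrite mul_diag_mx => /matrixP/(_ i 0).
    by rewrite !mxE => ->; rewrite dvdz_mulr.
  exists (invmx U *m \col_i (((v i 0)%R - (w i 0)%R) %/ d`_i)%Z).
  rewrite eB eD -!mulmxA mulKVmx // -mulmxBr; congr (_ *m _).
  apply/matrixP => i j; rewrite mul_diag_mx !mxE (ord1 j) mulrC divzK //.
(* Every class is that of a vector of residues in these coordinates. *)
have -> : lattice_index (range (mulmx B)) = #|` fset_set (range F)|.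
  rewrite /lattice_index; congr (#|` fset_set _|); apply/seteqP; split => A.
    move=> [v _ <-]; pose w := invmx L *m v.
    have hw i : (`|((w i 0)%R %% d`_i)%Z| < q i)%N.
      by rewrite -ltz_nat gez0_abs ?modz_ge0 ?ltz_mod.
    exists [ffun i => Ordinal (hw i)] => //.
    apply/lattice_class_eqP; rewrite -[v](mulKVmx uL); apply/key => i.
    rewrite mxE ffunE /= gez0_abs ?modz_ge0 // -eqz_mod_dvd modz_mod.
    exact: eqxx.
  by move=> [f _ <-]; exists (L *m \col_i (f i)%:Z).
rewrite card_fset_set_range.
  rewrite card_dep_ffun foldrE big_map big_enum dq.
  by apply: eq_bigr => i _; rewrite card_ord.
move=> f g /lattice_class_eqP /key h.
apply/ffunP => i; apply/val_inj => /=; have := h i; rewrite !mxE.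
rewrite -eqz_mod_dvd -!(modz_abs _ d`_i) !modz_nat => /eqP[].
by rewrite !modn_small ?ltn_ord.
Qed.

(** * Determinants of points in one class *)

Lemma pairwise_coprime_map (I : eqType) (s : seq I) (P : pred I) (f : I -> nat) :
  uniq s -> {in s &, forall i j, i != j -> coprime (f i) (f j)} ->
  pairwise coprime [seq f i | i <- s & P i].
Proof.
move=> us cs; rewrite pairwise_map.
apply: (@sub_in_pairwise _ [in s] [rel i j | i != j]); first exact: cs.
  by apply/allP => i; rewrite mem_filter => /andP[].
by rewrite -uniq_pairwise filter_uniq.
Qed.

Lemma sum_ln_natr (R : realType) (I : Type) (s : seq I) (P : pred I) (f : I -> nat) :
  (forall i, P i -> 0 < f i)%N ->
  \sum_(i <- s | P i) ln (f i)%:R = ln (\prod_(i <- s | P i) f i)%N%:R :> R.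
Proof.
move=> f0; elim: s => [|i s IHs]; first by rewrite !big_nil ln1.
rewrite !big_cons; case: ifP => // Pi.
rewrite natrM lnM ?posrE ?ltr0n ?f0 ?IHs //.
exact: prodn_cond_gt0.
Qed.

Definition int_simplex_mx (m : nat) (v : 'I_m.+1 -> 'cV[int]_m) : 'M[int]_m.+1 :=
  col_mx (const_mx 1 : 'rV_m.+1) (\matrix_(i < m, j < m.+1) v j i 0).

Lemma D_int_point (R : realType) (m : nat) (v : 'I_m.+1 -> 'cV[int]_m) :
  D (fun j => int_point R (v j)) = `|\det (int_simplex_mx v)|%N%:R.
Proof.
rewrite /D [RHS]pmulrn abszE intr_norm -det_map_mx; congr (`|\det _|).
rewrite /simplex_mx /int_simplex_mx; apply/matrixP => i j; rewrite !mxE.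
by case: splitP => k _; rewrite !mxE.
Qed.

Lemma lattice_index_gt0 (m : nat) (Gamma : set 'cV[int]_m) :
  full_rank_lattice Gamma -> (0 < lattice_index Gamma)%N.
Proof. by case=> B B0 ->; rewrite lattice_index_det // absz_gt0. Qed.

(** With v_j = v_0 + B x_j, the matrix of the simplex v factors as the block
    matrix (1, 0; v_0, B) times the matrix of the simplex x. *)
Lemma lattice_index_dvd (m : nat) (Gamma : set 'cV[int]_m)
    (v : 'I_m.+1 -> 'cV[int]_m) :
  full_rank_lattice Gamma ->
  (forall j, lattice_class Gamma (v j) = lattice_class Gamma (v ord0)) ->
  (lattice_index Gamma %| `|\det (int_simplex_mx v)|)%N.
Proof.
move=> [B B0 ->] hv.
have [x hx] := boolp.choice (fun j => (lattice_class_eqP B _ _).1 (hv j)).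
rewrite lattice_index_det //.
have -> : int_simplex_mx v = block_mx (scalar_mx 1 : 'M[int]_1) 0 (v ord0) B *m
    int_simplex_mx x.
  rewrite /int_simplex_mx mul_block_col mul1mx mul0mx addr0.
  have -> : \matrix_(i < m, j < m.+1) v j i 0 =
      v ord0 *m const_mx 1 + B *m \matrix_(i < m, j < m.+1) x j i 0 => //.
  apply/matrixP => i j.
  have := hx j => /matrixP/(_ i 0); rewrite !mxE big_ord1 !mxE mulr1.
  move/(canRL (subrK _)) ->; rewrite addrC; congr (_ + _).
  by apply: eq_bigr => k _; rewrite mxE.
have detE : \det (block_mx (scalar_mx 1 : 'M[int]_1) 0 (v ord0) B) = \det B.
  by rewrite det_lblock det1 mul1r.
rewrite det_mulmx abszM.
(* The same determinant, with the dimension 1 + m read as m.+1. *)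
have -> : \det (block_mx (scalar_mx 1 : 'M[int]_1) 0 (v ord0) B : 'M[int]_m.+1)
    = \det B by exact: detE.
exact: dvdn_mulr.
Qed.

(** * Counting tuples in one class *)

Lemma sum_ffact_le_card (n k nu : nat) (c : 'I_n -> 'I_nu)
    (P : pred {ffun 'I_k.+1 -> 'I_n}) :
  (forall f : {ffun 'I_k.+1 -> 'I_n}, injective f ->
     (forall j, c (f j) = c (f ord0)) -> P f) ->
  (\sum_(a < nu) #|[pred i | c i == a]| ^_ k.+1 <=
   #|[pred f : {ffun 'I_k.+1 -> 'I_n} | injectiveb f & P f]|)%N.
Proof.
move=> hP; pose E a := [set f in ffun_on [pred i | c i == a] |
                          injectiveb (f : {ffun 'I_k.+1 -> 'I_n})].
have -> : (\sum_(a < nu) #|[pred i | c i == a]| ^_ k.+1 = \sum_a #|E a|)%N.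
  by apply: eq_bigr => a _; rewrite card_inj_ffuns_on card_ord.
have memE a f : f \in E a -> injective f /\ forall j, c (f j) = a.
  rewrite inE => /andP[/ffun_onP h /injectiveP fi]; split=> // j.
  by apply/eqP; have := h j.
rewrite -sum1_card (eq_bigr (fun a => \sum_(f in E a) 1)%N); last first.
  by move=> a _; rewrite sum1_card.
rewrite (exchange_big_dep (fun f =>
  f \in [pred f : {ffun 'I_k.+1 -> 'I_n} | injectiveb f & P f])) /=.
  apply: leq_sum => f _; rewrite sum1_card.
  rewrite -(card1 (c (f ord0))); apply: subset_leq_card; apply/fintype.subsetP => a fa.
  by have [_ /(_ ord0) <-] := memE a f fa; rewrite inE.
move=> a f _ fE; have [fi fa] := memE _ _ fE; rewrite inE (introT (injectiveP _) fi) /=.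
by apply: hP => // j; rewrite !fa.
Qed.

(** Jensen's inequality for the falling factorial: when the tangent lines at
    the mean n / nu are added over the classes, their linear parts cancel. *)
Lemma sum_ffact_ge (R : realFieldType) (n k nu : nat) (Z : 'I_nu -> nat) :
  (0 < nu)%N -> (k.+1 * nu <= n)%N -> (\sum_a Z a)%N = n ->
  n%:R * \prod_(i < k) (n%:R / nu%:R - i.+1%:R) <=
    (\sum_a Z a ^_ k.+1)%N%:R :> R.
Proof.
move=> nu0 hn sZ; set x : R := n%:R / nu%:R.
have nu0' : (nu%:R : R) != 0 by rewrite pnatr_eq0 -lt0n.
have hx : k.+1%:R <= x + 1.
  apply: le_trans (_ : x <= _); last by rewrite lerDl.
  by rewrite ler_pdivlMr ?ltr0n // -natrM ler_nat.
have [g g0 hg] := ffact_tangent hx.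
(* The sum of the tangent lines at x: the factor nu of its constant part is
   absorbed by the factor x = n / nu for i = 0. *)
have -> : n%:R * \prod_(i < k) (x - i.+1%:R) =
    \sum_(a < nu) (\prod_(i < k.+1) (x - i%:R) + g * ((Z a)%:R - x)).
  rewrite big_split /= sumr_const card_ord.
  rewrite -[\prod_(i < k.+1) _ *+ nu]mulr_natr -mulr_sumr.
  rewrite sumrB -natr_sum sZ sumr_const card_ord -(mulr_natr x) divfK // subrr.
  rewrite mulr0 addr0 big_ord_recl /= subr0 [RHS]mulrAC divfK //.
rewrite natr_sum; exact: ler_sum.
Qed.

(** * The sieve inequality *)

(** By coprimality the product of the indices of these lattices divides the
    integer D(v), which is positive and at most t(Omega). *)
Lemma sum_ln_index_le (R : realType) (m : nat) (Omega : set 'cV[R]_m)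
    (L : {fset (set 'cV[int]_m)}) (v : 'I_m.+1 -> 'cV[int]_m) :
  (t Omega < +oo)%E -> (forall j, Omega (int_point R (v j))) ->
  0 < D (fun j => int_point R (v j)) ->
  (forall Gamma, Gamma \in L -> full_rank_lattice Gamma) ->
  (forall Gamma Gamma', Gamma \in L -> Gamma' \in L -> Gamma <> Gamma' ->
     coprime (lattice_index Gamma) (lattice_index Gamma')) ->
  \sum_(Gamma <- L | `[< forall j, lattice_class Gamma (v j) =
                                   lattice_class Gamma (v ord0) >])
     ln (lattice_index Gamma)%:R <= ln (fine (t Omega)).
Proof.
move=> ht vO D0 hL hc.
have Dt : D (fun j => int_point R (v j)) <= fine (t Omega).
  have Dsup : ((D (fun j => int_point R (v j)))%:E <= t Omega)%E.
    by apply: ereal_sup_ubound; exists (fun j => int_point R (v j)).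
  rewrite -lee_fin fineK // fin_numElt ht andbT.
  exact: lt_le_trans (ltNyr _) Dsup.
apply: le_trans (_ : ln (D (fun j => int_point R (v j))) <= _); last first.
  by rewrite ler_ln // posrE // (lt_le_trans D0).
rewrite big_seq_cond sum_ln_natr => [|Gamma /andP[/hL/lattice_index_gt0]//].
rewrite -big_seq_cond D_int_point in D0 *.
rewrite ltr0n in D0; set P := \prod_(_ <- _ | _) _.
have PD : (P %| `|\det (int_simplex_mx v)|)%N.
  apply/unstable.Gauss_dvd_prod => [|Gamma GL /asboolP hG].
    apply: pairwise_coprime_map => [|G G' GL GL' /eqP GG']; first exact: fset_uniq.
    exact: hc.
  by apply: lattice_index_dvd => //; apply: hL.
rewrite ler_ln ?posrE ?ltr0n ?ler_nat //; first exact: dvdn_leq.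
exact: dvdn_gt0 PD.
Qed.

Lemma lattice_coloring (m n nu : nat) (Gamma S : set 'cV[int]_m)
    (p : 'I_n -> 'cV[int]_m) :
  (forall i, S (p i)) -> (lattice_classes Gamma S #<= `I_nu)%card ->
  exists c : 'I_n -> 'I_nu, forall i j, c i = c j ->
    lattice_class Gamma (p i) = lattice_class Gamma (p j).
Proof.
move=> pS /pcard_leP/unsquash h.
have memS i : lattice_classes Gamma S (lattice_class Gamma (p i)) by exists (p i).
have hlt i : (h (lattice_class Gamma (p i)) < nu)%N.
  exact: (@funS _ _ _ _ h _ (memS i)).
exists (fun i => Ordinal (hlt i)) => i j [].
by apply: (@inj _ _ _ h); rewrite inE.
Qed.

(** Double counting of the pairs of an injective (m+1)-tuple of the n points
    and a lattice that puts the tuple in one class. *)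
Lemma sieve_inequality (R : realType) (m n : nat) (Omega : set 'cV[R]_m)
    (S : set 'cV[int]_m) (L : {fset (set 'cV[int]_m)})
    (nu : set 'cV[int]_m -> nat) (p : 'I_n -> 'cV[int]_m) :
  (t Omega < +oo)%E -> (forall v, S v -> Omega (int_point R v)) ->
  (forall Gamma, Gamma \in L -> full_rank_lattice Gamma) ->
  (forall Gamma, Gamma \in L -> (1 <= nu Gamma)%N) ->
  (forall Gamma, Gamma \in L -> (lattice_classes Gamma S #<= `I_(nu Gamma))%card) ->
  (forall v : 'I_m.+1 -> 'cV[int]_m, injective v -> (forall j, S (v j)) ->
     0 < D (fun j => int_point R (v j))) ->
  (forall Gamma Gamma', Gamma \in L -> Gamma' \in L -> Gamma <> Gamma' ->
     coprime (lattice_index Gamma) (lattice_index Gamma')) ->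
  injective p -> (forall i, S (p i)) ->
  (forall Gamma, Gamma \in L -> (m.+1 * nu Gamma <= n)%N) ->
  \sum_(Gamma <- L) ln (lattice_index Gamma)%:R *
     (n%:R * \prod_(i < m) (n%:R / (nu Gamma)%:R - i.+1%:R)) <=
  (n ^_ m.+1)%:R * ln (fine (t Omega)) :> R.
Proof.
move=> ht hS hL hnu hcl hD hc pinj pS hn.
pose mono Gamma (f : {ffun 'I_m.+1 -> 'I_n}) :=
  `[< forall j, lattice_class Gamma (p (f j)) = lattice_class Gamma (p (f ord0)) >].
pose T := [pred f : {ffun 'I_m.+1 -> 'I_n} | injectiveb f].
apply: le_trans (_ : \sum_(f | T f) \sum_(Gamma <- L | mono Gamma f)
    ln (lattice_index Gamma)%:R <= _); last first.
  have -> : (n ^_ m.+1)%:R * ln (fine (t Omega)) = \sum_(f | T f) ln (fine (t Omega)).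
    rewrite sumr_const mulr_natl; congr (_ *+ _).
    by rewrite -[n]card_ord -[m.+1]card_ord -card_inj_ffuns cardsE !card_ord.
  apply: ler_sum => f /injectiveP fi.
  have pfi : injective (p \o f) by apply: inj_comp.
  by apply: (sum_ln_index_le ht _ _ hL hc) => [j|]; [apply: hS|apply: hD].
under [leRHS]eq_bigr do rewrite big_mkcond.
rewrite exchange_big /= big_seq [leRHS]big_seq; apply: ler_sum => Gamma GL.
have [c cP] := lattice_coloring pS (hcl _ GL).
rewrite -big_mkcondr sumr_const -[leRHS]mulr_natr; apply: ler_wpM2l.
  by rewrite ln_ge0 // ler1n lattice_index_gt0 //; apply: hL.
have sumZ : (\sum_a #|[pred i | c i == a]|)%N = n.
  rewrite -[RHS]card_ord -sum1_card (partition_big c xpredT) //=.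
  by apply: eq_bigr => a _; rewrite sum1_card.
apply: le_trans (sum_ffact_ge R (hnu _ GL) (hn _ GL) sumZ) _.
rewrite ler_nat; apply: sum_ffact_le_card => f fi fc.
by apply/asboolP => j; apply: cP.
Qed.

(** * The theorem *)

(** An infinite S would contain finite subsets larger than b. *)
Lemma finite_card_lt (R : realType) (T : choiceType) (S : set T) (b : R) :
  (forall (n : nat) (p : 'I_n -> T), injective p -> (forall i, S (p i)) ->
     n%:R < b) ->
  finite_set S /\ #|` fset_set S|%:R < b.
Proof.
move=> hb.
have fsetb (A : {fset T}) : [set` A] `<=` S -> #|` A|%:R < b.
  move=> AS; apply: (hb _ (tnth (in_tuple A))) => [i j|i].
    by apply/tuple_uniqP; exact: fset_uniq.
  by apply: AS; rewrite /= mem_tnth.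
have finS : finite_set S.
  apply: contrapT => /(infinite_set_fset (Num.truncn b).+1)[A /fsetb Ab].
  move=> hA; have := lt_le_trans (truncnS_gt b) (_ : _ <= #|` A|%:R).
  by rewrite ler_nat => /(_ hA) /(lt_trans Ab); rewrite ltxx.
by split=> //; apply: fsetb; rewrite fset_setK.
Qed.

Theorem theorem2p5 (R : realType) (m : nat) (hm : (2 <= m)%N)
    (Omega : set 'cV[R]_m)
    (hvol : (0 < volume Omega)%E)
    (ht : (t Omega < +oo)%E)
    (S : set 'cV[int]_m)
    (hS : forall v, S v -> Omega (int_point R v))
    (L : {fset (set 'cV[int]_m)})
    (hL0 : L != fset0)
    (hL : forall Gamma, Gamma \in L -> full_rank_lattice Gamma)
    (nu : set 'cV[int]_m -> nat)
    (hnu : forall Gamma, Gamma \in L -> (1 <= nu Gamma)%N)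
    (hclasses : forall Gamma, Gamma \in L ->
       (lattice_classes Gamma S #<= `I_(nu Gamma))%card)
    (hD : forall v : 'I_m.+1 -> 'cV[int]_m, injective v ->
       (forall j, S (v j)) -> 0 < D (fun j => int_point R (v j)))
    (hcoprime : forall Gamma Gamma', Gamma \in L -> Gamma' \in L ->
       Gamma <> Gamma' -> coprime (lattice_index Gamma) (lattice_index Gamma'))
    (hpos : 0 < \sum_(Gamma <- L)
                  ln (lattice_index Gamma)%:R / (nu Gamma)%:R ^+ m
                - ln (fine (t Omega))) :
  finite_set S /\
  (#|` fset_set S|)%:R <
    Num.max
      (gamma R m *
       \big[Num.max/0]_(1 <= s < m.+1 | ~~ (2 %| s)%N)
         ((\sum_(Gamma <- L) ln (lattice_index Gamma)%:R / (nu Gamma)%:R ^+ (m - s)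
             - ln (fine (t Omega)))
          / (\sum_(Gamma <- L) ln (lattice_index Gamma)%:R / (nu Gamma)%:R ^+ m
             - ln (fine (t Omega)))) `^ (s%:R^-1))
      (m.+1 * \max_(Gamma <- L) nu Gamma)%:R.
Proof.
apply: finite_card_lt => n p pinj pS.
rewrite lt_max ltr_nat.
have [|hmax] := ltnP n (m.+1 * \max_(Gamma <- L) nu Gamma); first by rewrite orbT.
rewrite orbF.
have hn Gamma : Gamma \in L -> (m.+1 * nu Gamma <= n)%N.
  by move=> GL; apply: leq_trans hmax; rewrite leq_mul2l /= leq_bigmax_seq.
have n0 : (0 < n)%N.
  have /fset0Pn[Gamma GL] := hL0.
  by apply: leq_trans (hn _ GL); rewrite muln_gt0 hnu.
have n0R : 0 < n%:R :> R by rewrite ltr0n.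
have nu0 Gamma : Gamma \in L -> 0 < (nu Gamma)%:R :> R by move=> GL; rewrite ltr0n hnu.
pose A s := \sum_(Gamma <- L) ln (lattice_index Gamma)%:R / (nu Gamma)%:R ^+ (m - s)
            - ln (fine (t Omega)) : R.
have A0E : A 0%N = \sum_(Gamma <- L) ln (lattice_index Gamma)%:R / (nu Gamma)%:R ^+ m
            - ln (fine (t Omega)) by rewrite /A subn0.
rewrite -A0E in hpos *.
apply: (@lt_gamma_bigmax R m A) => // [s|].
  (* A s >= A 0, because nu >= 1 and log |Gamma| >= 0. *)
  apply: lt_le_trans hpos _; rewrite lerD2r big_seq [leRHS]big_seq.
  apply: ler_sum => Gamma GL; apply: ler_wpM2l.
    by rewrite ln_ge0 // ler1n lattice_index_gt0 //; apply: hL.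
  rewrite lef_pV2 ?posrE ?exprn_gt0 ?nu0 // ler_weXn2l ?ler1n ?hnu //.
  by rewrite subn0 leq_subr.
(* After multiplication by n^(m+1) the alternating sum is the difference of
   the two sides of the sieve inequality. *)
rewrite -(pmulr_rle0 _ (exprn_gt0 m.+1 n0R)).
have ineq := sieve_inequality ht hS hL hnu hclasses hD hcoprime pinj pS hn.
rewrite -subr_le0 in ineq; apply: le_trans ineq.
rewrite le_eqVlt; apply/orP; left; apply/eqP.
pose c s : R := (esym_upto m s)%:R * (- n%:R^-1) ^+ s.
have -> : (n ^_ m.+1)%:R = n%:R ^+ m.+1 * \sum_(s < m.+1) c s.
  have := falling_expansion m (lt0r_neq0 n0R) (oner_neq0 R).
  under [in RHS]eq_bigr do rewrite expr1n divr1.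
  move=> <-; rewrite natr_ffact big_ord_recl subr0 divr1.
  by congr (_ * _); apply: eq_bigr.
under [X in _ = X - _]eq_big_seq => Gamma GL.
  rewrite falling_expansion ?lt0r_neq0 ?nu0 // mulrCA.
  over.
rewrite -mulr_sumr -mulrA -mulrBr; congr (_ * _).
under eq_bigr => s _ do rewrite /A mulrBr.
rewrite sumrB -mulr_suml; congr (_ - _).
under eq_bigr do rewrite mulr_sumr.
rewrite exchange_big /=; apply: eq_bigr => Gamma _.
by rewrite mulr_sumr; apply: eq_bigr => s _; rewrite /c; ring.
Qed.
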